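(* Let $J$ be an ideal on a countable set $E$. If $J$ has a topological representation, then $J$ is represented on the Cantor space $2^\omega$ by a $\sigma$-ideal generated by a family of compact nowhere dense sets. That is, there are a $\sigma$-ideal $I$ on $2^\omega$ generated by a family of compact nowhere dense subsets of $2^\omega$, a countable dense set $D\subseteq 2^\omega$ and a bijection $\rho:E\to D$ such that $J=\{a\subseteq E:\mathrm{cl}(\rho(a))\in I\}$, where $\mathrm{cl}$ is closure in $2^\omega$ and $\rho(a)$ is the image of $a$.
   Context: An ideal on a set $E$ is a family of subsets of $E$ closed under taking subsets and finite unions; it is always assumed to contain all singletons $\{s\}$, $s\in E$. A $\sigma$-ideal on a set $X$ is a family of subsets of $X$ closed under taking subsets and countable unions, assumed to contain all singletons of $X$. The $\sigma$-ideal generated by a family of sets is the smallest $\sigma$-ideal containing that family. Given a separable metrizable space $X$, a $\sigma$-ideal $I$ on $X$ and a countable dense set $D\subseteq X$, let $J_I=\{a\subseteq D:\mathrm{cl}(a)\in I\}$, where $\mathrm{cl}$ is closure in $X$. An ideal $J$ on a countable set $E$ has a topological representation if there are such $X$, $I$, $D$ and a bijection $\rho:E\to D$ with $J=\{a\subseteq E:\rho(a)\in J_I\}$, where $\rho(a)$ is the image of $a$; in this case $J$ is said to be represented on $X$ by $I$.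
   Formalization: The ideal J is assumed proper (E is not in J); for J = P(E), which is represented on a countable discrete space, the claim fails, since by Baire 2^ω is not in a σ-ideal generated by nowhere dense sets. *)

(* Defs.v *)
From mathcomp Require Import all_boot all_algebra.
From mathcomp Require Import boolp classical_sets functions cardinality reals.
From mathcomp Require Import topology cantor.

Set Implicit Arguments.
Unset Strict Implicit.
Unset Printing Implicit Defensive.

Local Open Scope classical_set_scope.

(* [J set0] is the empty finite union; the whole of [E] may belong to [J]. *)
Definition is_ideal (E : Type) (J : set (set E)) : Prop :=
  [/\ J set0,
      forall A B : set E, B `<=` A -> J A -> J B,
      forall A B : set E, J A -> J B -> J (A `|` B) &
      forall x : E, J [set x]].

Definition is_sigma_ideal (X : Type) (I : set (set X)) : Prop :=
  [/\ I set0,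
      forall A B : set X, B `<=` A -> I A -> I B,
      forall A : nat -> set X, (forall n, I (A n)) -> I (\bigcup_n A n) &
      forall x : X, I [set x]].

Definition generated_sigma_ideal (X : Type) (F : set (set X)) : set (set X) :=
  smallest (@is_sigma_ideal X) F.

Definition nowhere_dense (X : topologicalType) (A : set X) : Prop :=
  interior (closure A) = set0.

Definition separable (X : topologicalType) : Prop :=
  exists A : set X, countable A /\ dense A.

Definition closure_ideal (X : topologicalType) (I : set (set X)) (D : set X) :
  set (set X) := [set a | a `<=` D /\ I (closure a)].

Definition represented_on (E : Type) (J : set (set E))
    (X : topologicalType) (I : set (set X)) : Prop :=
  exists (D : set X) (rho : E -> X),
    [/\ countable D, dense D, set_bij [set: E] D rho &
        J = [set a : set E | closure_ideal I D (rho @` a)]].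

(* Only the topology of [X] enters [represented_on], so quantifying over metric
   spaces amounts to quantifying over metrizable ones. *)
Definition has_topological_representation (R : realType) (E : Type)
    (J : set (set E)) : Prop :=
  exists (X : metricType R) (I : set (set X)),
    [/\ separable X, is_sigma_ideal I & represented_on J I].

(* Main.v *)
(* Let [x n] be the traces on [E] of a countable base of the representing space.
   They separate sets in [J] from sets outside [J], and split every set outside
   [J] into two such sets.  Build a binary tree of cells outside [J], [T_s] being
   the disjoint union of its two children, such that every [x n] is decided
   modulo [J] by the cells of level [n + 1], while the sets in [J] where this
   fails are swept away from the children [s 1].  Each point of [E] has a branch
   in the Cantor space; a modification modulo [J] makes this map injective, and
   its range is dense because no cell is empty.  Let [F] be the closures of the
   images of the sets in [J].  If [b] is not in [J], every closure in [F] is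
   nowhere dense relative to the branches whose cells all meet [b] outside [J],
   so by the Baire category theorem countably many of them cannot cover the
   closure of the image of [b]; for [b = E] this also shows that the sets in [F]
   are nowhere dense. *)
Require Import Defs.
From mathcomp Require Import all_boot all_order all_algebra.
From mathcomp Require Import boolp classical_sets functions cardinality reals.
From mathcomp Require Import topology cantor.

Set Implicit Arguments.
Unset Strict Implicit.
Unset Printing Implicit Defensive.
Import Order.TTheory GRing.Theory Num.Theory.
Local Open Scope classical_set_scope.

(** * Traces of a countable base *)

Lemma countable_enumeration (T : Type) (t0 : T) :
  countable [set: T] -> exists f : nat -> T, forall t, exists n, f n = t.
Proof.
move=> /pfcard_geP[T0|[f]].
  by have : [set: T] t0 by []; rewrite T0.
exists f => t; have [n _ <-] := @surj _ _ _ _ f t I; by exists n.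
Qed.

(* [x] is the trace on [E] of a countable base of the representing space; the
   second clause holds because a set outside [I] has two points all of whose
   neighborhoods are outside [I]. *)
Lemma separating_traces (R : realType) (E : Type) (J : set (set E)) (e0 : E) :
  countable [set: E] -> has_topological_representation R J ->
  exists x : nat -> set E,
    (forall a b, J a -> ~ J b -> exists n, a `&` x n = set0 /\ ~ J (b `&` x n)) /\
    (forall b, ~ J b -> exists n, ~ J (b `&` x n) /\ ~ J (b `\` x n)).
Proof.
move=> Ecount [X [I [_ [I0 Isub Icup I1] [D [rho [_ Ddense [rhoD _ Drho] JE]]]]]].
have JP a : J a <-> I (closure (rho @` a)).
  rewrite JE; split=> [[_ ?]//|Ia]; split=> // _ [e _ <-]; exact: rhoD.
have countEn : countable [set: E * nat].
  by rewrite -setXTT; exact: countableX.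
have [f fsurj] := countable_enumeration (e0, 0%N) countEn.
pose U n : set X := (ball (rho (f n).1) (((f n).2.+1%:R)^-1 : R)%R)°.
have Uopen n : open (U n) by exact: open_interior.
have Ubase p A : nbhs p A -> exists n, U n p /\ U n `<=` A.
  move=> /nbhs_ballP[r /= r0 rA].
  have r20 : (0 < r / 2)%R by rewrite divr_gt0.
  have [k] := ltr_add_invr r20; rewrite add0r => kr.
  set d : R := (k.+1%:R^-1)%R in kr; have d0 : (0 < d)%R by rewrite invr_gt0.
  have d20 : (0 < d / 2)%R by rewrite divr_gt0.
  have [q [/interior_subset pq]] : (ball p (d / 2)%R)° `&` D !=set0.
    apply: Ddense; last exact: open_interior.
    by exists p; exact: nbhsx_ballx.
  move=> /Drho[e _ eq]; have [n fn] := fsurj (e, k); exists n.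
  rewrite /U fn /= eq -/d; split.
    apply: filterS (nbhsx_ballx _ _ d20) => y py.
    by rewrite [d]splitr; apply: ball_triangle py; exact: ball_sym.
  move=> y /interior_subset qy; apply: rA; rewrite [r]splitr.
  apply: ball_triangle (le_ball (ltW kr) qy); apply: le_ball pq.
  by apply: le_trans (ltW kr); rewrite ler_pdivrMr// ler_peMr ?(ltW d0)// ler1n.
pose x n := rho @^-1` U n.
(* The closure of the image of [b] is covered by [K] and the countably many closures of images of
   those traces of [b] that lie in [J]. *)
have cover (K : set X) (b : set E) : I K ->
    (forall p, closure (rho @` b) p -> ~ K p ->
      exists n, U n p /\ J (b `&` x n)) -> J b.
  move=> IK bK; apply/JP.
  pose C n : set X := if n is m.+1 then
      [set p | J (b `&` x m) /\ closure (rho @` (b `&` x m)) p] else K.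
  apply: (Isub (\bigcup_n C n)); last first.
    apply: Icup => -[//|n] /=; case: (pselect (J (b `&` x n))) => Jbn.
      by apply: (Isub _ _ _ ((JP _).1 Jbn)) => p [].
    by apply: (Isub _ _ _ I0) => p [].
  move=> p bp; have [Kp|nKp] := pselect (K p); first by exists 0%N.
  have [n [Unp Jbn]] := bK p bp nKp; exists n.+1 => //; split=> // B pB.
  have [_ [[e be <-] [Ue Be]]] := bp _ (filterI (open_nbhs_nbhs (conj (Uopen n) Unp)) pB).
  by exists (rho e); split=> //; exists e.
exists x; split=> [a b Ja nJb|b nJb].
  apply: contrapT => /forallNP nx; apply: nJb.
  apply: (cover (closure (rho @` a))); first exact/JP.
  move=> p _ /existsNP[B /not_implyP[pB aB]].
  have [n [Unp UnB]] := Ubase p B pB; exists n; split=> //.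
  apply: contrapT => nJ; apply: (nx n); split=> //.
  rewrite -subset0 => e [ae Une]; apply: aB; exists (rho e); split; first by exists e.
  exact: UnB.
(* Contrapositive of [cover]; taking [K] empty and then a singleton yields two distinct points. *)
have pos (K : set X) : I K -> exists p, [/\ closure (rho @` b) p, ~ K p &
    forall n, U n p -> ~ J (b `&` x n)].
  move=> IK; apply: contrapT => /forallNP H; apply: nJb; apply: cover IK _.
  move=> p bp nKp; apply: contrapT => /forallNP nn; apply: (H p); split=> //.
  by move=> n Unp Jn; apply: (nn n).
have [p [_ _ pP]] := pos _ I0; have [q [_ /eqP qp qP]] := pos _ (I1 p).
have := @metric_hausdorff _ X; rewrite open_hausdorff => /(_ _ _ qp).
move=> [[A B] /= [/set_mem Aq /set_mem Bp] [oA oB /eqP AB]].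
have [n [Unq UnA]] := Ubase _ _ (open_nbhs_nbhs (conj oA Aq)).
have [m [Ump UmB]] := Ubase _ _ (open_nbhs_nbhs (conj oB Bp)).
exists n; split; first exact: qP.
move=> Jn; apply: (pP m Ump); apply/JP; apply: (Isub _ _ _ ((JP _).1 Jn)).
apply/closure_subset/image_subset => e [be xe]; split=> // ne.
by have : (A `&` B) (rho e) by [split; [exact: UnA|exact: UmB]]; rewrite AB.
Qed.

(** * Initial segments and neighborhoods in the Cantor space *)

(* Finite binary sequences are stored with the last digit first. *)
Fixpoint restr (z : nat -> bool) n : seq bool :=
  if n is m.+1 then z m :: restr z m else [::].

Lemma size_restr z n : size (restr z n) = n.
Proof. by elim: n => //= n ->. Qed.

Lemma restr_eqP (y z : nat -> bool) n :
  restr y n = restr z n <-> forall i, (i < n)%N -> y i = z i.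
Proof.
elim: n => [|n IH] //=; split=> [[yz /IH H] i|H].
  by rewrite ltnS leq_eqVlt => /orP[/eqP->|/H].
by congr (_ :: _); [exact: H|apply/IH => i /ltnW; apply: H].
Qed.

Lemma nbhs_restr (z : cantor_space) n :
  nbhs z [set y : cantor_space | restr y n = restr z n].
Proof.
elim: n => [|n IH]; first by apply: filterE.
have zn : nbhs z [set y : cantor_space | y n = z n].
  have := @proj_continuous nat (fun=> bool) n z [set z n].
  apply; exact: discrete_set1.
by apply: filterS2 zn IH => y /= -> ->.
Qed.

(** Otherwise points outside [A] that agree with [z] on ever longer initial segments would converge
    to [z]. *)
Lemma nbhs_restr_sub (z : cantor_space) (A : set cantor_space) :
  nbhs z A -> exists n, forall y, restr y n = restr z n -> A y.
Proof.
move=> zA; apply: contrapT => /forallNP nA.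
have /choice[u uP] n : exists y, restr y n = restr z n /\ ~ A y.
  by have /existsNP[y /not_implyP] := nA n; exists y.
have uz : u @ \oo --> z.
  apply/cvg_sup => N U [V] [[W] oW <-] WfN WU.
  apply: (filterS WU); rewrite nbhs_simpl; exists N.+1 => // i /= Ni.
  by have [/restr_eqP/(_ N Ni) ->] := uP i.
by have [n _ /(_ n (leqnn n)) un] := uz _ zA; have [_] := uP n.
Qed.

(** * The tree of cells *)

Section Tree.
Variables (E : Type) (J : set (set E)) (x : nat -> set E) (p q : nat -> E).
Hypotheses (J0 : J set0) (Jsub : forall A B : set E, B `<=` A -> J A -> J B)
  (JU : forall A B : set E, J A -> J B -> J (A `|` B))
  (J1 : forall e : E, J [set e]).
Hypothesis x_sep : forall a b, J a -> ~ J b ->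
  exists n, a `&` x n = set0 /\ ~ J (b `&` x n).
Hypothesis x_split : forall b, ~ J b ->
  exists n, ~ J (b `&` x n) /\ ~ J (b `\` x n).
Hypothesis pq_onto : forall e e', exists n, p n = e /\ q n = e'.
Hypothesis JE : ~ J [set: E].

Definition decided n (A : set E) : Prop := J (A `&` x n) \/ J (A `\` x n).

Lemma decided_sub n (A B C : set E) :
  B `<=` A `|` C -> J C -> decided n A -> decided n B.
Proof.
by move=> BAC JC [JA|JA]; [left|right]; apply: Jsub (JU JA JC);
  move=> e [/BAC[Ae|Ce] xe]; [left|right|left|right].
Qed.

(** If [x n] is undecided on [A], it splits [A] itself; if it is decided, both halves of any
    positive splitting inherit the decision. *)
Lemma deciding_split n (A : set E) : exists y, ~ J A ->
  [/\ ~ J (A `&` y), ~ J (A `\` y), decided n (A `&` y) & decided n (A `\` y)].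
Proof.
have [JA|nJA] := pselect (J A); first by exists set0.
have [d|nd] := pselect (decided n A).
  have [k [Jk1 Jk2]] := x_split nJA; exists (x k) => _; split=> //.
    by apply: decided_sub d => [e []|]; [left|exact: J0].
  by apply: decided_sub d => [e []|]; [left|exact: J0].
exists (x n) => _; split.
- by move=> ?; apply: nd; left.
- by move=> ?; apply: nd; right.
- by right; apply: Jsub J0 => e [[_ ?] []].
- by left; apply: Jsub J0 => e [[_ ?] ?].
Qed.

Variable Y : nat -> set E -> set E.
Hypothesis YP : forall n A, ~ J A ->
  [/\ ~ J (A `&` Y n A), ~ J (A `\` Y n A),
      decided n (A `&` Y n A) & decided n (A `\` Y n A)].

(* [Y n T] is changed only modulo [J]: dropping [u] makes junk run along the
   branches ending in zeros, and treating [p n] and [q n] differently makes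
   distinct points end up on distinct branches. *)
Definition cut n (T u : set E) : set E :=
  (Y n T `\` (u `|` [set q n])) `|` [set p n].

(* [x n] is decided on [T] up to this subset of [T]. *)
Definition exception n (T : set E) : set E :=
  if `[< J (T `&` x n) >] then T `&` x n else T `\` x n.

Fixpoint tree (s : seq bool) : set E * set E :=
  if s is b :: s' then
    let y := cut (size s') (tree s').1 (tree s').2 in
    let T := if b then (tree s').1 `&` y else (tree s').1 `\` y in
    (T, (tree s').2 `|` exception (size s') T)
  else (setT, set0).

Definition cell s := (tree s).1.
Definition junk s := (tree s).2.

Lemma cutP n (T u : set E) : J u -> ~ J T ->
  [/\ ~ J (T `&` cut n T u), ~ J (T `\` cut n T u),
      decided n (T `&` cut n T u) & decided n (T `\` cut n T u)].
Proof.
move=> Ju nJT; have [nJ1 nJ2 d1 d2] := YP n nJT.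
have Juq : J (u `|` [set q n]) by exact: JU.
split.
- move=> JT; apply: nJ1; apply: Jsub (JU JT Juq) => e [Te Ye].
  have [uq|nuq] := pselect ((u `|` [set q n]) e); [by right|left].
  by split=> //; left.
- move=> JT; apply: nJ2; apply: Jsub (JU JT (J1 (p n))) => e [Te nYe].
  have [->|pe] := pselect (e = p n); [by right|left].
  by split=> // -[[]|].
- by apply: decided_sub d1 => [e [Te [[]|]]|]; [left|right|exact: (J1 (p n))].
- apply: decided_sub Juq d2 => e [Te ne].
  have [uq|nuq] := pselect ((u `|` [set q n]) e); [by right|left].
  by split=> // Ye; apply: ne; left.
Qed.

Lemma tree_invariant s : ~ J (cell s) /\ J (junk s).
Proof.
elim: s => [|b s [nJT Ju]]; first by split.
have [nJ1 nJ2 d1 d2] := cutP (size s) Ju nJT.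
rewrite /cell /junk /=; set T := if b then _ else _.
have [nJ d] : ~ J T /\ decided (size s) T by rewrite /T; case: (b).
split=> //; apply: JU => //; rewrite /exception; case: asboolP => // nJx.
by case: d.
Qed.

Lemma cell_cons b s e :
  cell (b :: s) e <->
  cell s e /\ b = `[< cut (size s) (cell s) (junk s) e >].
Proof.
rewrite /cell /=; case: b; case: asboolP => c; split.
all: by [case|move=> []].
Qed.

Lemma cell_cat t s : cell (t ++ s) `<=` cell s.
Proof. by elim: t => //= b t IH e /cell_cons[/IH]. Qed.

Lemma junk_cat t s : junk s `<=` junk (t ++ s).
Proof. by elim: t => //= b t IH e /IH; left. Qed.

(** [cut] removes the junk and only afterwards restores the point [p n]. *)
Lemma cell_true_junk s : cell (true :: s) `&` junk s `<=` [set p (size s)].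
Proof.
move=> e [/cell_cons[_ /esym/asboolP] [[_ nu] ue|//]].
by exfalso; apply: nu; left.
Qed.

(** The exception for [x n] enters the junk at level [n + 1]; below that, cells shrink and junk
    grows. *)
Lemma cell_decided n s : (n < size s)%N ->
  cell s `&` x n `<=` junk s \/ cell s `\` x n `<=` junk s.
Proof.
elim: s => // b s IH; rewrite /= ltnS leq_eqVlt => /orP[/eqP->|/IH H].
  change (junk (b :: s)) with (junk s `|` exception (size s) (cell (b :: s))).
  by rewrite /exception; case: asboolP => _; [left|right] => e ?; right.
have sub := @cell_cat [:: b] s; have jsub := @junk_cat [:: b] s.
by case: H => H; [left|right] => e [/sub ce xe]; apply: jsub; apply: H.
Qed.

Lemma cell_eq s t e : size s = size t -> cell s e -> cell t e -> s = t.
Proof.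
elim: s t => [|b s IH] [|c t] //= [st] /cell_cons[se ->] /cell_cons[te ->].
by rewrite (IH t st se te).
Qed.

(** * Extending cells while keeping a part of [b] outside [J] *)

Lemma positive_extend (b : set E) s m : ~ J (b `&` cell s) ->
  exists t, size t = m /\ ~ J (b `&` cell (t ++ s)).
Proof.
move=> nJ; elim: m => [|m [t [tm nJt]]]; first by exists [::].
apply: contrapT => /forallNP H; apply: nJt.
have Jc c : J (b `&` cell (c :: t ++ s)).
  by apply: contrapT => nJc; apply: (H (c :: t)); rewrite /= tm.
apply: Jsub (JU (Jc true) (Jc false)) => e [be te].
by case: (boolP `[< cut (size (t ++ s)) (cell (t ++ s)) (junk (t ++ s)) e >]) =>
  [c|/negPf c]; [left|right]; split=> //; apply/cell_cons.
Qed.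

(** Split the part of [b] by some [x k] and extend both halves past level [k]. They cannot reach the
    same cell, where [x k] is decided, so one of them avoids the chain [P]. *)
Lemma positive_avoid (P : seq bool -> Prop) (b : set E) s :
  (forall t t', P t -> P t' -> size t = size t' -> t = t') ->
  ~ J (b `&` cell s) -> exists t, ~ P (t ++ s) /\ ~ J (b `&` cell (t ++ s)).
Proof.
move=> Pchain /x_split[k [nJ1 nJ2]].
have {}nJ1 : ~ J (b `&` x k `&` cell s) by rewrite setIAC.
have {}nJ2 : ~ J ((b `\` x k) `&` cell s).
  by apply: contra_not nJ2; apply: Jsub => e [[be ce] nxe].
have [t1 [st1 nJt1]] := positive_extend k.+1 nJ1.
have [t2 [st2 nJt2]] := positive_extend k.+1 nJ2.
have [P1|nP1] := pselect (P (t1 ++ s)); last first.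
  by exists t1; split=> //; apply: contra_not nJt1; apply: Jsub => e [[]].
have [P2|nP2] := pselect (P (t2 ++ s)); last first.
  by exists t2; split=> //; apply: contra_not nJt2; apply: Jsub => e [[]].
have t12 : t1 ++ s = t2 ++ s by apply: Pchain => //; rewrite !size_cat st1 st2.
have [_ Ju] := tree_invariant (t1 ++ s).
have kt : (k < size (t1 ++ s))%N by rewrite size_cat st1 ltn_addr.
exfalso; case: (cell_decided kt) => H.
  by apply: nJt1; apply: Jsub Ju => e [[_ ?] ?]; apply: H.
by apply: nJt2; rewrite -t12; apply: Jsub Ju => e [[_ ?] ?]; apply: H.
Qed.

(* Once [s] is long, [a] meets [cell s] only inside [junk s]; leaving the
   branch [s 0 0 0 ...] cuts this down to one point, which is then avoided. *)
Lemma positive_clear (a b : set E) s : J a -> ~ J (b `&` cell s) ->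
  exists t, a `&` cell (t ++ s) = set0 /\ ~ J (b `&` cell (t ++ s)).
Proof.
move=> Ja nJ; have [n [an nJn]] := x_sep Ja nJ.
have {}nJn : ~ J (b `&` x n `&` cell s) by rewrite setIAC.
have [t1 [st1 nJ1]] := positive_extend n.+1 nJn.
set s1 := t1 ++ s in nJ1.
have [_ Ju1] := tree_invariant s1.
have au : a `&` cell s1 `<=` junk s1.
  have ns1 : (n < size s1)%N by rewrite size_cat st1 ltn_addr.
  case: (cell_decided ns1) => H.
    by exfalso; apply: nJ1; apply: Jsub Ju1 => e [[_ xe] ce]; apply: H.
  move=> e [ae ce]; apply: H; split=> // xe.
  by have : (a `&` x n) e by []; rewrite an.
have {}nJ1 : ~ J (b `&` cell s1).
  by apply: contra_not nJ1; apply: Jsub => e [[]].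
pose zeros k := nseq (k - size s1) false ++ s1.
have [|t2 [/eqP nP nJ2]] := @positive_avoid (fun w => w = zeros (size w)) b s1 _ nJ1.
  by move=> t t' Pt Pt' st; rewrite Pt Pt' st.
have t2P : true \in t2.
  apply: contraNT nP => nt2; rewrite /zeros size_cat addnK; apply/eqP; congr (_ ++ _).
  by apply/all_pred1P/allP => -[] // t2t; rewrite t2t in nt2.
case/splitPr: t2P nP nJ2 => l r _; rewrite -catA cat_cons => nJ2.
set s2 := l ++ true :: r ++ s1 in nJ2.
(* In the [true] child of [r ++ s1], what is left of [a] is old junk, so only the restored point can
   survive. *)
have ap : a `&` cell s2 `<=` [set p (size (r ++ s1))].
  move=> e [ae /cell_cat c2]; apply: cell_true_junk; split=> //.
  apply/junk_cat/au; split=> //.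
  by have /(@cell_cat (true :: r)) := c2.
have [t3 [nP nJ3]] := @positive_avoid (fun w => cell w (p (size (r ++ s1)))) b s2
  (fun t t' ct ct' st => cell_eq st ct ct') nJ2.
exists (t3 ++ l ++ true :: r ++ t1); rewrite -!catA cat_cons -catA; split=> //.
rewrite -subset0 => e [ae /[dup] c3 /cell_cat c2]; apply: nP.
by rewrite -(ap e (conj ae c2)).
Qed.

(** * The map from [E] to the Cantor space *)

Fixpoint address e n : seq bool :=
  if n is m.+1 then
    `[< cut m (cell (address e m)) (junk (address e m)) e >] :: address e m
  else [::].

Definition branch e : cantor_space :=
  fun n => `[< cut n (cell (address e n)) (junk (address e n)) e >].

Lemma restr_branch e n : restr (branch e) n = address e n.
Proof. by elim: n => //= n ->. Qed.

Lemma cell_branch s e : cell s e <-> restr (branch e) (size s) = s.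
Proof.
have ce n : cell (address e n) e.
  elim: n => //= n IH; apply/cell_cons; split=> //; congr `[< cut _ _ _ _ >].
  by rewrite -restr_branch size_restr.
rewrite restr_branch; split=> [se|<-//].
by apply: cell_eq (ce _) se; rewrite -restr_branch size_restr.
Qed.

(** At a level [n] with [p n = e] and [q n = e'], distinct points get the digits [true] and [false]
    if their branches agree so far. *)
Lemma branch_inj : injective branch.
Proof.
move=> e e' ee'; apply: contrapT => ne.
have [n [pn qn]] := pq_onto e e'.
have t1 : branch e n by apply/asboolP; right; rewrite pn.
have t2 : branch e' n by rewrite -ee'.
move/asboolP: t2 => [[_]|]; first by apply; right.
by rewrite pn => /esym.
Qed.

Lemma cell_nonempty (b : set E) s : ~ J (b `&` cell s) ->
  exists e, b e /\ cell s e.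
Proof.
move=> nJ; apply: contrapT => /forallNP H; apply: nJ.
by apply: Jsub J0 => e [be ce]; apply: (H e).
Qed.

Lemma closure_branchP (a : set E) z :
  (forall n, exists e, a e /\ cell (restr z n) e) <->
  closure (branch @` a) z.
Proof.
split=> [az B /nbhs_restr_sub[n nB]|az n].
  have [e [ae /cell_branch]] := az n; rewrite size_restr => re.
  by exists (branch e); split; [exists e|apply: nB].
have [_ [[e ae <-] re]] := az _ (nbhs_restr z n).
by exists e; split=> //; apply/cell_branch; rewrite size_restr.
Qed.

Lemma branch_dense : dense (range branch).
Proof.
move=> O [z Oz] oO.
have : closure (range branch) z.
  apply/closure_branchP => n; apply: cell_nonempty.
  by rewrite setTI; have [] := tree_invariant (restr z n).
move=> /(_ O (open_nbhs_nbhs (conj oO Oz)))[y [yr yO]].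
by exists y.
Qed.

(** * Relative category *)

(* Nowhere density relative to the closed set of the branches all of whose
   cells meet [b] outside [J]. *)
Definition small (b : set E) (C : set cantor_space) : Prop :=
  forall s, ~ J (b `&` cell s) -> exists t, ~ J (b `&` cell (t ++ s)) /\
    forall z, C z -> restr z (size (t ++ s)) <> t ++ s.

Lemma small_closure (a b : set E) : J a -> small b (closure (branch @` a)).
Proof.
move=> Ja s nJ; have [t [at0 nJt]] := positive_clear Ja nJ.
exists t; split=> // z /closure_branchP az rz.
have [e [ae]] := az (size (t ++ s)); rewrite rz => ce.
by have : (a `&` cell (t ++ s)) e by []; rewrite at0.
Qed.

(** No cell is in [J], so relative to the whole of [E] every basic open set contains one missed by
    [C]. *)
Lemma small_nowhere_dense (C : set cantor_space) : closed C ->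
  small [set: E] C -> nowhere_dense C.
Proof.
move=> /closure_id; rewrite /nowhere_dense => <- sC; rewrite -subset0.
move=> z /nbhs_restr_sub[n nC].
have [|t [nJ tC]] := sC (restr z n).
  by rewrite setTI; have [] := tree_invariant (restr z n).
have [e [_ ce]] := cell_nonempty nJ.
apply: (tC (branch e)); last exact/cell_branch.
by apply: nC; have /cell_branch := cell_cat ce; rewrite size_restr.
Qed.

Definition meager (b : set E) : set (set cantor_space) :=
  [set A | exists C : nat -> set cantor_space,
    (forall n, small b (C n)) /\ A `<=` \bigcup_n C n].

Lemma small0 b : small b set0.
Proof. by move=> s nJ; exists [::]; split. Qed.

Lemma meager_sigma_ideal b : is_sigma_ideal (meager b).
Proof.
split.
- by exists (fun=> set0); split=> // n; exact: small0.
- by move=> A B BA [C [sC AsubC]]; exists C; split=> //; exact: subset_trans AsubC.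
- move=> A /choice[C CP].
  (* Numbers that code no pair are sent to the empty set, which is small. *)
  pose C' k : set cantor_space :=
    if unpickle k is Some nm then C nm.1 nm.2 else set0.
  exists C'; split=> [k|z [n _ Az]].
    by rewrite /C'; case: unpickle => [nm|]; [exact: (CP nm.1).1|exact: small0].
  have [m _ Cz] := (CP n).2 z Az.
  by exists (pickle (n, m)) => //; rewrite /C' pickleK.
- move=> z; exists (fun=> [set z]); split=> [_ s nJ|y yz]; last by exists 0%N.
  (* The initial segments of [z] form a chain, one of each length. *)
  have [|t [nP nJt]] := @positive_avoid (fun w => restr z (size w) = w) b s _ nJ.
    by move=> t t' <- <- ; rewrite !size_restr => ->.
  by exists t; split=> // _ ->.
Qed.

Lemma restr_nth (w : seq bool) : restr (nth false (rev w)) (size w) = w.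
Proof.
elim: w => //= c w IH; rewrite rev_cons nth_rcons size_rev ltnn eqxx.
congr (_ :: _); rewrite -[RHS]IH; apply/restr_eqP => i iw.
by rewrite nth_rcons size_rev iw.
Qed.

(** Baire category argument: nested positive cells [S n] avoid the sets [C n] one by one, and all of
    them meet [b], so their common branch [z] lies in the closure. *)
Lemma closure_not_meager (b : set E) : ~ J b ->
  ~ meager b (closure (branch @` b)).
Proof.
move=> nJb [C [sC bC]].
have /choice[g gP] : forall ns : nat * seq bool, exists t,
    ~ J (b `&` cell ns.2) -> [/\ (0 < size t)%N, ~ J (b `&` cell (t ++ ns.2)) &
      forall z, C ns.1 z -> restr z (size (t ++ ns.2)) <> t ++ ns.2].
  move=> [n s] /=; have [Jb|nJ] := pselect (J (b `&` cell s)); first by exists [::].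
  (* One extra digit makes [t] nonempty, so the lengths of the [S n] are unbounded. *)
  have [t1 [st1 nJ1]] := positive_extend 1 nJ.
  have [t2 [nJ2 tC]] := sC n _ nJ1; exists (t2 ++ t1) => _.
  by rewrite -catA size_cat st1 addn1.
pose S := fix S n := if n is m.+1 then g (m, S m) ++ S m else [::].
have SP n : ~ J (b `&` cell (S n)).
  elim: n => [|n IH]; first by rewrite setIT.
  by have [] := gP (n, S n) IH.
have Ssize n : (n <= size (S n))%N.
  elim: n => //= n IH; rewrite size_cat; have [g0 _ _] := gP (n, S n) (SP n).
  by rewrite -addn1 addnC leq_add.
have Scat n m : exists t, S (m + n)%N = t ++ S n.
  elim: m => [|m [t IH]]; first by exists [::].
  by exists (g (m + n, S (m + n))%N ++ t); rewrite -catA -IH.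
have Snth n m i : (i < size (S n))%N -> (n <= m)%N ->
    nth false (rev (S m)) i = nth false (rev (S n)) i.
  move=> iS nm; have [t] := Scat n (m - n)%N; rewrite subnK // => ->.
  by rewrite rev_cat nth_cat size_rev iS.
(* [S i.+1] has more than [i] digits, so the default [false] is never read. *)
pose z : cantor_space := fun i => nth false (rev (S i.+1)) i.
have zS n : restr z (size (S n)) = S n.
  rewrite -[RHS]restr_nth; apply/restr_eqP => i iS; rewrite /z.
  have [ni|ni] := leqP n i.+1; first exact: Snth.
  by rewrite (Snth i.+1 n) // ltnW.
have /bC[n _ Cz] : closure (branch @` b) z.
  apply/closure_branchP => n.
  have [e [be ce]] := cell_nonempty (SP n); exists e; split=> //.
  have /restr_eqP H : restr (branch e) (size (S n)) = restr z (size (S n)).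
    by rewrite zS; exact/cell_branch.
  apply/cell_branch; rewrite size_restr; apply/restr_eqP => i ni.
  by apply: H; exact: leq_trans (Ssize n).
have [_ _ /(_ z Cz)] := gP (n, S n) (SP n); apply.
exact: (zS n.+1).
Qed.

End Tree.

(** * The representation on the Cantor space *)

Lemma generated_sigma_idealP (X : Type) (F : set (set X)) :
  is_sigma_ideal (generated_sigma_ideal F).
Proof.
split.
- by move=> I [[]].
- by move=> A B BA GA I IF; case: (IF) => -[_ Isub _ _] _; exact: Isub (GA I IF).
- move=> A GA I IF; case: (IF) => -[_ _ Icup _] _; apply: Icup => n.
  exact: GA.
- by move=> z I [[]].
Qed.

(* [JE] says that the ideal is proper, which forces [E] to be infinite: neither
   the improper ideal nor a finite [E] admits such a representation. *)
Theorem theorem1p3 (R : realType) (E : Type) (J : set (set E))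
    (Ecount : countable [set: E]) (Jideal : is_ideal J) (JE : ~ J [set: E])
    (Jrep : has_topological_representation R J) :
  exists (I F : set (set cantor_space)),
    [/\ forall K : set cantor_space, F K -> compact K /\ nowhere_dense K,
        is_sigma_ideal I,
        I = generated_sigma_ideal F &
        represented_on J I].
Proof.
have [J0 Jsub JU J1] := Jideal.
have [e0 _] : exists e : E, True.
  apply: contrapT => /forallNP nE; apply: JE.
  by apply: Jsub J0 => e; have := nE e.
have [x [x_sep x_split]] := separating_traces e0 Ecount Jrep.
have cEE : countable [set: E * E] by rewrite -setXTT; exact: countableX.
have [pq pq_surj] := countable_enumeration (e0, e0) cEE.
pose p n := (pq n).1; pose q n := (pq n).2.
have pq_onto e e' : exists n, p n = e /\ q n = e'.
  by have [n pqn] := pq_surj (e, e'); exists n; rewrite /p /q pqn.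
have /choice[Y' Y'P] := fun nA : nat * set E =>
  deciding_split J0 Jsub JU x_split nA.1 nA.2.
pose Y n A := Y' (n, A); have YP n A := Y'P (n, A).
pose br := branch J x p q Y.
pose F := [set closure (br @` a) | a in J].
exists (generated_sigma_ideal F), F; split=> //.
- move=> _ [a Ja <-]; split.
    apply: (@subclosed_compact _ _ [set: cantor_space]) => //.
    - exact: closed_closure.
    - exact: cantor_space_compact.
  apply: (@small_nowhere_dense _ J x p q J0 Jsub JU J1 JE Y YP).
    exact: closed_closure.
  exact: small_closure.
- exact: generated_sigma_idealP.
- exists (range br), br; split.
  + exact: sub_countable (card_image_le _ _) Ecount.
  + exact: branch_dense.
  + split; first by move=> e _; exists e.
    * by move=> e e' _ _; exact: branch_inj.
    * by [].
  + apply/seteqP; split=> [a Ja|a [_ Ia]].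
    * split; first by move=> _ [e _ <-]; exists e.
      by apply: sub_gen_smallest; exists a.
    (* The meager sets relative to [a] form a sigma-ideal containing [F], hence the generated one,
       but omit the closure of the image of [a]. *)
    * apply: contrapT => nJa.
      apply: (@closure_not_meager _ J x p q J0 Jsub JU Y a nJa).
      apply: (smallest_sub _ _ Ia).
        exact: meager_sigma_ideal.
      move=> _ [c Jc <-]; exists (fun=> closure (br @` c)); split.
        by move=> _; exact: small_closure.
      by move=> z; exists 0%N.
Qed.
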